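(* Suppose Assumptions A1, A3, A4 and B1 hold. Let $\{w_k\}$ be generated by the inexact subsampled Newton-CG method $w_{k+1}=w_k+p_k^r$, where $p_k^r$ is the result of $r$ conjugate gradient iterations, started from $p^0=0$, applied to $\nabla^2R_{S_k}(w_k)p=-\nabla R(w_k)$, with $$|S_k|=\beta\ge\frac{64\sigma^2}{\bar\mu^2}$$ for all $k$, and with $\delta(\beta)=L_\beta/\mu_\beta>1$ and $$r\ge\log\left(\frac{16L}{\mu_\beta}\sqrt{\delta(\beta)}\right)\Big/\log\left(\frac{\sqrt{\delta(\beta)}+1}{\sqrt{\delta(\beta)}-1}\right).$$ If $\|w_0-w^*\|\le\min\left\{\frac1{4C_1},\frac1{4\gamma C_1}\right\}$ with $C_1=\frac{M}{2\mu_\beta}$, then for all $k\ge0$, $$\mathbb{E}[\|w_{k+1}-w^*\|]\le\tfrac12\,\mathbb{E}[\|w_k-w^*\|].$$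
   Context: Setting (finite sum): $R(w)=\frac1N\sum_{i=1}^NF_i(w)$ for $w\in\mathbb{R}^d$, each $F_i$ twice continuously differentiable. For an index multiset $S$, $\nabla^2R_S(w)=\frac1{|S|}\sum_{i\in S}\nabla^2F_i(w)$. At each iteration $S_k$ consists of $\beta$ indices drawn independently and uniformly from $\{1,\dots,N\}$, independent of the past; the full gradient $\nabla R(w_k)$ is used. $w^*$ is the unique minimizer of $R$. Assumption A1 (for $R$): for every positive integer $\beta$ there are $0<\mu_\beta\le L_\beta$ with $\mu_\beta I\preceq\nabla^2R_S(w)\preceq L_\beta I$ for all $w$ and all $|S|=\beta$; constants $0<\bar\mu\le\mu_\beta$, $L_\beta\le\bar L<\infty$ for all $\beta$; and $\mu I\preceq\nabla^2R(w)\preceq LI$ for all $w$. Assumption A3: $\|\nabla^2R(w)-\nabla^2R(z)\|\le M\|w-z\|$ for all $w,z$. Assumption A4: with $i$ uniform on $\{1,\dots,N\}$, $\|\mathbb{E}[(\nabla^2F_i(w)-\nabla^2R(w))^2]\|\le\sigma^2$ for all $w$. Assumption B1: there is $\gamma>0$ such that every iterate satisfies $\mathbb{E}[\|w_k-w^*\|^2]\le\gamma(\mathbb{E}[\|w_k-w^*\|])^2$. *)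

(* Defs.v *)
From mathcomp Require Import ssreflect ssrfun ssrbool eqtype ssrnat seq choice fintype bigop tuple.
From Stdlib Require Import Reals.
Set Implicit Arguments. Unset Strict Implicit. Unset Printing Implicit Defensive.
Open Scope R_scope.

Definition vec (d : nat) := 'I_d -> R.
Definition mat (d : nat) := 'I_d -> 'I_d -> R.

Section LinAlg.
Variable d : nat.
Definition vzero : vec d := fun _ => 0.
Definition vadd (u v : vec d) : vec d := fun i => u i + v i.
Definition vsub (u v : vec d) : vec d := fun i => u i - v i.
Definition vopp (u : vec d) : vec d := fun i => - u i.
Definition vscale (a : R) (u : vec d) : vec d := fun i => a * u i.
Definition dot (u v : vec d) : R := \big[Rplus/0]_(i < d) (u i * v i).
Definition vnorm (u : vec d) : R := sqrt (dot u u).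
Definition mv (A : mat d) (u : vec d) : vec d :=
  fun i => \big[Rplus/0]_(j < d) (A i j * u j).
Definition msub (A B : mat d) : mat d := fun i j => A i j - B i j.
Definition mmul (A B : mat d) : mat d :=
  fun i j => \big[Rplus/0]_(k < d) (A i k * B k j).
Definition loewner_between (a : R) (A : mat d) (b : R) : Prop :=
  forall v : vec d, a * dot v v <= dot v (mv A v) /\ dot v (mv A v) <= b * dot v v.
Definition opnorm_le (A : mat d) (c : R) : Prop :=
  forall v : vec d, vnorm (mv A v) <= c * vnorm v.

Definition is_gradient (f : vec d -> R) (g : vec d -> vec d) : Prop :=
  forall w : vec d, forall eps : R, 0 < eps -> exists delta : R, 0 < delta /\
    forall h : vec d, vnorm h < delta ->
      Rabs (f (vadd w h) - f w - dot (g w) h) <= eps * vnorm h.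
Definition is_jacobian (g : vec d -> vec d) (H : vec d -> mat d) : Prop :=
  forall w : vec d, forall eps : R, 0 < eps -> exists delta : R, 0 < delta /\
    forall h : vec d, vnorm h < delta ->
      vnorm (vsub (vsub (g (vadd w h)) (g w)) (mv (H w) h)) <= eps * vnorm h.
Definition mat_continuous (H : vec d -> mat d) : Prop :=
  forall w : vec d, forall eps : R, 0 < eps -> exists delta : R, 0 < delta /\
    forall z : vec d, vnorm (vsub z w) < delta ->
      forall i j, Rabs (H z i j - H w i j) < eps.

(* conjugate gradient on A p = b, started from p^0 = 0; state (x, residual, direction) *)
Definition cg_step (A : mat d) (st : vec d * vec d * vec d) : vec d * vec d * vec d :=
  let: (x, r, p) := st in
  let Ap := mv A p in
  let a := dot r r / dot p Ap in
  let x' := vadd x (vscale a p) in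
  let r' := vsub r (vscale a Ap) in
  let b := dot r' r' / dot r r in
  (x', r', vadd r' (vscale b p)).
Definition cg (A : mat d) (b : vec d) (n : nat) : vec d :=
  (iter n (cg_step A) (vzero, b, b)).1.1.
End LinAlg.

Section FiniteSum.
Variables (d N : nat).
Definition Rfun (F : 'I_N -> vec d -> R) (w : vec d) : R :=
  / INR N * \big[Rplus/0]_(i < N) F i w.
Definition gradR (gF : 'I_N -> vec d -> vec d) (w : vec d) : vec d :=
  fun k => / INR N * \big[Rplus/0]_(i < N) gF i w k.
Definition hessR (HF : 'I_N -> vec d -> mat d) (w : vec d) : mat d :=
  fun k l => / INR N * \big[Rplus/0]_(i < N) HF i w k l.
(* subsampled Hessian nabla^2 R_S(w) for an index multiset S (a sequence) *)
Definition hessS (HF : 'I_N -> vec d -> mat d) (S : seq 'I_N) (w : vec d) : mat d :=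
  fun k l => / INR (size S) * \big[Rplus/0]_(i <- S) HF i w k l.
Definition hess_var (HF : 'I_N -> vec d -> mat d) (w : vec d) : mat d :=
  fun k l => / INR N * \big[Rplus/0]_(i < N)
     mmul (msub (HF i w) (hessR HF w)) (msub (HF i w) (hessR HF w)) k l.

Definition is_unique_minimizer (f : vec d -> R) (ws : vec d) : Prop :=
  (forall w, f ws <= f w) /\ (forall w, (forall z, f w <= f z) -> w = ws).

Definition newton_cg_step (gF : 'I_N -> vec d -> vec d) (HF : 'I_N -> vec d -> mat d)
  (r : nat) (w : vec d) (S : seq 'I_N) : vec d :=
  vadd w (cg (hessS HF S w) (vopp (gradR gF w)) r).
Definition newton_cg_iter (gF : 'I_N -> vec d -> vec d) (HF : 'I_N -> vec d -> mat d)
  (r : nat) (w0 : vec d) (ss : seq (seq 'I_N)) : vec d :=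
  foldl (newton_cg_step gF HF r) w0 ss.

Definition avgT (T : finType) (f : T -> R) : R :=
  (\big[Rplus/0]_(t : T) f t) / INR #|T|.

(* E[ f(w_k) ]: each S_j consists of beta indices drawn independently and
   uniformly from {1..N} (a beta-tuple), independently across iterations,
   so (S_0,...,S_{k-1}) is uniform over k-tuples of beta-tuples. *)
Definition expect_iter (gF : 'I_N -> vec d -> vec d) (HF : 'I_N -> vec d -> mat d)
  (beta r : nat) (w0 : vec d) (k : nat) (f : vec d -> R) : R :=
  avgT (fun t : k.-tuple (beta.-tuple 'I_N) =>
          f (newton_cg_iter gF HF r w0 (map (fun S : beta.-tuple 'I_N => tval S) (tval t)))).
End FiniteSum.

(* Main.v *)
(**
  Write e = w - w*, H for the full Hessian and A for the subsampled one at w, and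
  let x solve A x = - grad R(w). The error after one step splits as
  (e + x) - (x - p^r). Since A (e + x) = (A - H) e + (H e - grad R(w)), the first
  part is at most C_1 |e|^2 + |(A - H) e| / mu_beta by coercivity of A and Lipschitz
  continuity of H; averaging over the sample, the second moment of |(A - H) e| is
  that of a single index divided by beta, which gives |e| / 8. The CG error is also
  at most |e| / 8. Assumption B1 turns E|e|^2 into gamma (E|e|)^2, and E|e| stays
  below |w_0 - w*|, so the total is at most (1/4 + 1/8 + 1/8) E|e|.

  The CG bound needs no spectral theorem. CG minimises the A-norm of the error over
  the Krylov space, so it suffices to bound T_k(B) for the rescaled matrix B; Pell's
  identity T_k^2 + (1 - B^2) U_(k-1)^2 = 1 does this as soon as 1 - B^2 >= 0.
*)

Require Import Defs.
From mathcomp Require Import ssreflect ssrfun ssrbool eqtype ssrnat seq choice fintype bigop tuple.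
From mathcomp Require Import ssralg matrix mxalgebra Rstruct.
From Stdlib Require Import Reals Lra FunctionalExtensionality.
Set Implicit Arguments. Unset Strict Implicit. Unset Printing Implicit Defensive.
Open Scope R_scope.

(** * Linear algebra on coordinate vectors *)

Section Surj.
Import GRing.Theory.
Local Open Scope ring_scope.
(** Row vectors multiply from the left, so [M] is the transpose of [A]. Injectivity empties its left
    kernel, which makes it a unit, and the inverse supplies the preimage. *)
Lemma mv_surj d (A : mat d) :
  (forall v, mv A v = vzero (d:=d) -> v = vzero (d:=d)) ->
  forall b, exists x, mv A x = b.
Proof.
move=> inj b.
pose M : 'M[R]_d := \matrix_(i, j) A j i.
have mulM (v : 'rV[R]_d) i : (v *m M) ord0 i = mv A (fun j => v ord0 j) i.
  by rewrite mxE; apply: eq_bigr => j _; rewrite mxE mulrC.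
have MU : M \in unitmx.
  rewrite -row_free_unit -kermx_eq0; apply/eqP/row_matrixP => i; rewrite row0.
  have : row i (kermx M) *m M = 0 by apply/sub_kermxP; exact: row_sub.
  move: (row i (kermx M)) => v vM.
  have v0 : (fun j => v ord0 j) = vzero (d:=d).
    by apply: inj; apply: functional_extensionality => j; rewrite -mulM vM mxE.
  by apply/rowP => j; rewrite mxE; exact: (congr1 (fun f => f j) v0).
exists (fun j => ((\row_i b i) *m invmx M) ord0 j).
by apply: functional_extensionality => i; rewrite -mulM mulmxKV // mxE.
Qed.
End Surj.

Ltac vext := apply: functional_extensionality => ?;
  rewrite /vadd /vsub /vscale /vopp /vzero; try ring.

Section LinearAlgebra.
Variable d : nat.
Implicit Types (u v w : vec d) (A B : mat d) (a b c : R).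

Lemma dotC u v : dot u v = dot v u.
Proof. by apply: eq_bigr => i _; rewrite Rmult_comm. Qed.
Lemma dotDl u v w : dot (vadd u v) w = dot u w + dot v w.
Proof. by rewrite /dot -big_split; apply: eq_bigr => i _ /=; rewrite /vadd; ring. Qed.
Lemma dotZl a u w : dot (vscale a u) w = a * dot u w.
Proof. by rewrite /dot big_distrr; apply: eq_bigr => i _ /=; rewrite /vscale; ring. Qed.
Lemma dotBl u v w : dot (vsub u v) w = dot u w - dot v w.
Proof.
have -> : vsub u v = vadd u (vscale (-1) v) by vext.
rewrite dotDl dotZl; ring.
Qed.
Lemma dotNl u w : dot (vopp u) w = - dot u w.
Proof.
have -> : vopp u = vscale (-1) u by vext.
rewrite dotZl; ring.
Qed.
Lemma dot0l u : dot (vzero (d:=d)) u = 0.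
Proof.
have -> : vzero (d:=d) = vscale 0 u by vext.
rewrite dotZl; ring.
Qed.
Lemma dotDr u v w : dot w (vadd u v) = dot w u + dot w v.
Proof. by rewrite dotC dotDl !(dotC w). Qed.
Lemma dotZr a u w : dot w (vscale a u) = a * dot w u.
Proof. by rewrite dotC dotZl (dotC w). Qed.
Lemma dotBr u v w : dot w (vsub u v) = dot w u - dot w v.
Proof. by rewrite dotC dotBl !(dotC w). Qed.
Lemma dotNr u w : dot w (vopp u) = - dot w u.
Proof. by rewrite dotC dotNl (dotC w). Qed.
Lemma dot0r u : dot u (vzero (d:=d)) = 0.
Proof. by rewrite dotC dot0l. Qed.

Lemma mvD A u v : mv A (vadd u v) = vadd (mv A u) (mv A v).
Proof.
apply: functional_extensionality => i; rewrite /vadd /mv -big_split.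
by apply: eq_bigr => j _ /=; ring.
Qed.
Lemma mvZ A a u : mv A (vscale a u) = vscale a (mv A u).
Proof.
apply: functional_extensionality => i; rewrite /vscale /mv big_distrr.
by apply: eq_bigr => j _ /=; ring.
Qed.
Lemma mvB A u v : mv A (vsub u v) = vsub (mv A u) (mv A v).
Proof.
have -> : vsub u v = vadd u (vscale (-1) v) by vext.
by rewrite mvD mvZ; vext.
Qed.
Lemma mv0 A : mv A (vzero (d:=d)) = vzero (d:=d).
Proof.
have -> : vzero (d:=d) = vscale 0 (vzero (d:=d)) by vext.
by rewrite mvZ; vext.
Qed.
Lemma mv_msub A B u : mv (msub A B) u = vsub (mv A u) (mv B u).
Proof.
have -> : vsub (mv A u) (mv B u) = vadd (mv A u) (vscale (-1) (mv B u)) by vext.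
apply: functional_extensionality => i; rewrite /vadd /vscale /mv big_distrr -big_split.
by apply: eq_bigr => j _ /=; rewrite /msub; ring.
Qed.
Lemma mv_mmul A B u : mv (mmul A B) u = mv A (mv B u).
Proof.
apply: functional_extensionality => i; rewrite /mv /mmul.
under eq_bigr do rewrite big_distrl /=.
rewrite exchange_big; apply: eq_bigr => j _ /=; rewrite big_distrr.
by apply: eq_bigr => k _ /=; ring.
Qed.

Lemma dot_ge0 u : 0 <= dot u u.
Proof. by apply: (big_ind (fun x => 0 <= x)) => [|x y hx hy|i _]; [lra|lra|nra]. Qed.
Lemma dot_eq0 u : dot u u = 0 -> u = vzero (d:=d).
Proof.
move=> u0; apply: functional_extensionality => i.
set s := \big[Rplus/0]_(j < d | j != i) (u j * u j).
have s0 : 0 <= s by apply: (big_ind (fun x => 0 <= x)) => [|x y hx hy|j _]; [lra|lra|nra].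
have {}u0 : u i * u i + s = 0 by rewrite -u0 /dot (bigD1 i).
rewrite /vzero; nra.
Qed.

Lemma le_of_sqr_le a b : 0 <= b -> a ^ 2 <= b ^ 2 -> a <= b.
Proof. by move=> b0 h; nra. Qed.

Lemma quadratic_disc a b c : (forall t, 0 <= a + 2 * b * t + c * t ^ 2) -> b ^ 2 <= a * c.
Proof.
move=> q; have a0 := q 0.
case: (Req_dec c 0) => [c0|c0].
  subst c; case: (Req_dec b 0) => [->|b0]; first by lra.
  (* With [c = 0] the polynomial is affine in [t], and this [t] gives it the value -1. *)
  have := q (- (a + 1) / (2 * b)).
  have -> : a + 2 * b * (- (a + 1) / (2 * b)) + 0 * (- (a + 1) / (2 * b)) ^ 2 = -1
    by field.
  lra.
have c_gt0 : 0 < c.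
  case: (Rlt_le_dec 0 c) => // c_le0; exfalso.
  (* For [c < 0] this [t >= 1] is large enough for the quadratic term to outweigh the other two. *)
  have := q ((Rabs a + 2 * Rabs b + 1) / - c + 1); set t := _ + 1 => qt.
  have ct : Rabs a + 2 * Rabs b + 1 = - c * (t - 1) by rewrite /t; field.
  have t1 : 1 <= t.
    have : 0 <= (Rabs a + 2 * Rabs b + 1) / - c.
      have := Rabs_pos a; have := Rabs_pos b => hb ha.
      apply: Rmult_le_pos; first by lra.
      by apply: Rlt_le; apply: Rinv_0_lt_compat; lra.
    rewrite /t; lra.
  have := Rle_abs a; have := Rle_abs b; have := Rabs_pos a; have := Rabs_pos b.
  nra.
(* The vertex of the parabola. *)
have := q (- b / c).
have -> : a + 2 * b * (- b / c) + c * (- b / c) ^ 2 = (a * c - b ^ 2) / c by field; lra.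
move=> h; have := Rmult_le_compat_l c _ _ (Rlt_le _ _ c_gt0) h.
have -> : c * ((a * c - b ^ 2) / c) = a * c - b ^ 2 by field; lra.
lra.
Qed.

Lemma vnorm_ge0 u : 0 <= vnorm u.
Proof. exact: sqrt_pos. Qed.
Lemma vnorm_sqr u : vnorm u ^ 2 = dot u u.
Proof. by rewrite /vnorm /= Rmult_1_r sqrt_sqrt //; exact: dot_ge0. Qed.
Lemma vnorm_le u a : 0 <= a -> dot u u <= a ^ 2 -> vnorm u <= a.
Proof. by move=> a0 h; have := vnorm_sqr u; have := vnorm_ge0 u; nra. Qed.
Lemma vnorm_eq0 u : vnorm u = 0 -> u = vzero (d:=d).
Proof. by move=> h; apply: dot_eq0; rewrite -vnorm_sqr h; ring. Qed.
Lemma vnorm0 : vnorm (vzero (d:=d)) = 0.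
Proof. by rewrite /vnorm dot0l sqrt_0. Qed.

Lemma dot_le_vnorm u v : dot u v <= vnorm u * vnorm v.
Proof.
have cs : dot u v ^ 2 <= dot u u * dot v v.
  apply: quadratic_disc => t; have := dot_ge0 (vadd u (vscale t v)).
  rewrite !(dotDl, dotDr, dotZl, dotZr) (dotC v u); lra.
rewrite -!vnorm_sqr in cs; apply: le_of_sqr_le; last by lra.
by apply: Rmult_le_pos; exact: vnorm_ge0.
Qed.

Lemma vnormD u v : vnorm (vadd u v) <= vnorm u + vnorm v.
Proof.
have hu := vnorm_ge0 u; have hv := vnorm_ge0 v; apply: vnorm_le; first by lra.
rewrite !(dotDl, dotDr) (dotC v u) -!vnorm_sqr; have := dot_le_vnorm u v; nra.
Qed.
Lemma vnormZ a u : vnorm (vscale a u) = Rabs a * vnorm u.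
Proof.
rewrite /vnorm dotZl dotZr -Rmult_assoc sqrt_mult ?sqrt_Rsqr_abs //; last exact: dot_ge0.
nra.
Qed.
Lemma vnormN u : vnorm (vopp u) = vnorm u.
Proof. by rewrite /vnorm dotNl dotNr Ropp_involutive. Qed.

(** Take [v = u]. This reduces estimates of vector-valued differences to scalar functions, to which
    the mean value theorem applies. *)
Lemma vnorm_le_dual u a : 0 <= a ->
  (forall v, dot v u <= a * vnorm v) -> vnorm u <= a.
Proof.
by move=> a0 h; have := h u; rewrite -vnorm_sqr => hu; have u0 := vnorm_ge0 u; nra.
Qed.

Definition msym A := forall u v, dot u (mv A v) = dot (mv A u) v.

Lemma sym_psd_cauchy_schwarz A u v : msym A -> (forall w, 0 <= dot w (mv A w)) ->
  dot u (mv A v) ^ 2 <= dot u (mv A u) * dot v (mv A v).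
Proof.
move=> sA pA; apply: quadratic_disc => t; have := pA (vadd u (vscale t v)).
rewrite !(mvD, mvZ, dotDl, dotDr, dotZl, dotZr) (dotC v (mv A u)) -sA; lra.
Qed.

(** Cauchy-Schwarz for the form of [A] passes from the diagonal bound to the bilinear one; it stands
    in for an operator norm bound. *)
Lemma sym_form_le A b u v : msym A -> loewner_between 0 A b -> 0 <= b ->
  dot u (mv A v) <= b * vnorm u * vnorm v.
Proof.
move=> sA Ab b0.
have pA w : 0 <= dot w (mv A w) by have := proj1 (Ab w); lra.
have cs := sym_psd_cauchy_schwarz u v sA pA.
have [lu hu] := Ab u; have [lv hv] := Ab v; rewrite -!vnorm_sqr in hu hv.
have u0 := vnorm_ge0 u; have v0 := vnorm_ge0 v.
have h0 : 0 <= b * vnorm u * vnorm v by apply: Rmult_le_pos => //; apply: Rmult_le_pos.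
apply: le_of_sqr_le => //; have := Rmult_le_compat _ _ _ _ (pA u) (pA v) hu hv; nra.
Qed.

Lemma coercive_vnorm A a b v : loewner_between a A b -> a * vnorm v <= vnorm (mv A v).
Proof.
move=> Aab; have [h _] := Aab v; rewrite -vnorm_sqr in h.
have := dot_le_vnorm v (mv A v); have := vnorm_ge0 v; have := vnorm_ge0 (mv A v).
move=> h1 h2 h3; case: (Req_dec (vnorm v) 0) => [->|]; nra.
Qed.

Lemma coercive_surj A a b : 0 < a -> loewner_between a A b -> forall y, exists x, mv A x = y.
Proof.
move=> a0 Aab; apply: mv_surj => v Av; apply: vnorm_eq0.
by have := coercive_vnorm v Aab; rewrite Av vnorm0; have := vnorm_ge0 v; nra.
Qed.

End LinearAlgebra.

(** * Conjugate gradients *)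

Section ConjugateGradient.
Variables (d : nat) (A : mat d) (b : vec d).
Hypothesis symA : msym A.
Implicit Types (u v w x y r p : vec d).

(** The span of [b, A b, ..., A^(k-1) b], in Horner form: [v = q(A) b] with [q] of degree below
    [k]. *)
Fixpoint krylov (k : nat) (v : vec d) : Prop :=
  match k with
  | O => v = vzero (d:=d)
  | k'.+1 => exists c u, krylov k' u /\ v = vadd (vscale c b) (mv A u)
  end.

Lemma krylov0 k : krylov k (vzero (d:=d)).
Proof.
elim: k => //= k IH; exists 0, (vzero (d:=d)); split => //.
by rewrite mv0; vext.
Qed.
Lemma krylovD k u v : krylov k u -> krylov k v -> krylov k (vadd u v).
Proof.
elim: k u v => [u v /= -> ->|k IH u v /=]; first by vext.
move=> [c [u' [Ku ->]]] [e [v' [Kv ->]]]; exists (c + e), (vadd u' v').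
by split; [exact: IH | rewrite mvD; vext].
Qed.
Lemma krylovZ k a u : krylov k u -> krylov k (vscale a u).
Proof.
elim: k u => [u /= ->|k IH u /= [c [u' [Ku ->]]]]; first by vext.
by exists (a * c), (vscale a u'); split; [exact: IH | rewrite mvZ; vext].
Qed.
Lemma krylovB k u v : krylov k u -> krylov k v -> krylov k (vsub u v).
Proof.
move=> Ku Kv; have -> : vsub u v = vadd u (vscale (-1) v) by vext.
exact: krylovD Ku (krylovZ _ Kv).
Qed.
Lemma krylov_mv k u : krylov k u -> krylov k.+1 (mv A u).
Proof. by move=> Ku; exists 0, u; split => //; vext. Qed.
Lemma krylov_rhs k : krylov k.+1 b.
Proof.
exists 1, (vzero (d:=d)); split; first exact: krylov0.
by rewrite mv0; vext.
Qed.
Lemma krylovS k u : krylov k u -> krylov k.+1 u.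
Proof.
elim: k u => [u /= ->|k IH u [c [u' [Ku ->]]]]; first exact: (krylov0 1).
by exists c, u'; split; first exact: IH.
Qed.

(* The last field is a basis-free form of [K_(k+1) = K_k + R p]: it fails only
   after the residual has vanished, when CG has already found the solution. *)
Record cg_inv (k : nat) (x r p : vec d) : Prop := CgInv {
  cg_x : krylov k x;
  cg_r : r = vsub b (mv A x);
  cg_rK : krylov k.+1 r;
  cg_pK : krylov k.+1 p;
  cg_r_orth : forall v, krylov k v -> dot r v = 0;
  cg_p_conj : forall v, krylov k v -> dot p (mv A v) = 0;
  cg_rp : dot r p = dot r r;
  cg_span : r <> vzero (d:=d) -> forall v, krylov k.+1 v ->
    exists c u, krylov k u /\ v = vadd u (vscale c p) }.

Hypothesis posA : forall v, v <> vzero (d:=d) -> 0 < dot v (mv A v).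

Lemma cg_inv_step k x r p : cg_inv k x r p ->
  let: (x', r', p') := cg_step A (x, r, p) in cg_inv k.+1 x' r' p'.
Proof.
case=> Kx rE Kr Kp orth conj rp span /=.
set a := dot r r / dot p (mv A p).
set r' := vsub r (vscale a (mv A p)).
set x' := vadd x (vscale a p).
set be := dot r' r' / dot r r.
have Kx' : krylov k.+1 x' by apply: krylovD (krylovS Kx) (krylovZ _ Kp).
have r'E : r' = vsub b (mv A x').
  by rewrite /r' /x' rE mvD mvZ; vext.
have Kr' : krylov k.+2 r'.
  apply: krylovB; first exact: krylovS.
  by apply: krylovZ; apply: krylov_mv.
have Kp' : krylov k.+2 (vadd r' (vscale be p)).
  by apply: krylovD => //; apply: krylovZ; apply: krylovS.
(* After the residual vanishes, both quotients have numerator 0 and so are 0 whatever the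
   denominator: [x] stays put, the new residual and direction are zero, and the spanning field holds
   vacuously. *)
have [r0|r0] : r = vzero (d:=d) \/ r <> vzero (d:=d).
  case: (Req_dec (dot r r) 0) => h; first by left; apply: dot_eq0.
  by right => r0; apply: h; rewrite r0 dot0l.
  have a0 : a = 0 by rewrite /a r0 dot0l /Rdiv Rmult_0_l.
  have r'0 : r' = vzero (d:=d) by rewrite /r' a0 r0; vext.
  have be0 : be = 0 by rewrite /be r'0 dot0l /Rdiv Rmult_0_l.
  have p'0 : vadd r' (vscale be p) = vzero (d:=d) by rewrite r'0 be0; vext.
  by split => //; try (move=> v _); rewrite ?p'0 ?r'0 ?dot0l ?dot0r.
have rr : dot r r <> 0 by move=> h; apply: r0; apply: dot_eq0.
have pAp : dot p (mv A p) <> 0.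
  move=> h; have p0 : p <> vzero (d:=d) by move=> p0; apply: rr; rewrite -rp p0 dot0r.
  by have := posA p0; lra.
have a0 : a <> 0.
  by rewrite /a => h; apply: rr;
     rewrite -[LHS]Rmult_1_r -(Rinv_l _ pAp) -Rmult_assoc -/(Rdiv _ _) h; ring.
(* Reading the residual update backwards turns conjugacy to [p] into orthogonality of residuals. *)
have Ap : mv A p = vscale (/ a) (vsub r r').
  by rewrite /r'; apply: functional_extensionality => i; rewrite /vscale /vsub; field.
have orth' v : krylov k.+1 v -> dot r' v = 0.
  move=> Kv; have [c [u [Ku ->]]] := span r0 v Kv.
  rewrite dotDr dotZr /r' !dotBl !dotZl orth // -symA conj // rp (dotC (mv A p) p) /a.
  by field.
have conj' v : krylov k.+1 v -> dot (vadd r' (vscale be p)) (mv A v) = 0.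
  move=> Kv; have [c [u [Ku ->]]] := span r0 v Kv.
  have r'Au : dot r' (mv A u) = 0 by apply: orth'; exact: krylov_mv.
  have r'Ap : dot r' (mv A p) = - / a * dot r' r'.
    by rewrite Ap dotZr dotBr orth' //; ring.
  have pAp' : dot p (mv A p) = / a * dot r r by rewrite /a; field.
  rewrite mvD mvZ dotDr dotZr !(dotDl r') !(dotZl be) r'Au r'Ap pAp' (conj u Ku) /be.
  by field; split.
split => //.
- by rewrite (dotDr r' (vscale be p)) (dotZr be p) (orth' p Kp); ring.
- move=> _ v [c [u [Ku ->]]]; have [e [u' [Ku' ->]]] := span r0 u Ku.
  (* Here [v = c b + A u' + e A p]. Replace [A p] by [(r - r') / a] and [r'] by the new direction
     minus [be p]: the new direction gets coefficient [- e / a], and the rest lies in the previous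
     Krylov space. *)
  exists (- e / a), (vadd (vadd (vscale c b) (mv A u'))
                       (vadd (vscale (e / a) r) (vscale (e / a * be) p))); split.
    apply: krylovD; first apply: krylovD.
    + exact: krylovZ _ (krylov_rhs k).
    + exact: krylov_mv.
    + by apply: krylovD; apply: krylovZ.
  rewrite mvD mvZ Ap; apply: functional_extensionality => i.
  by rewrite /vadd /vscale /vsub; field.
Qed.

Lemma cg_inv_iter k :
  let: (x, r, p) := iter k (cg_step A) (vzero (d:=d), b, b) in cg_inv k x r p.
Proof.
elim: k => [|k IH].
  split => //; try (by move=> v ->; rewrite ?mv0 dot0r).
  - by rewrite mv0; vext.
  - exact: krylov_rhs.
  - exact: krylov_rhs.
  - move=> _ v [c [u [-> ->]]]; exists c, (vzero (d:=d)); split => //.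
    by rewrite mv0; vext.
rewrite iterS; move: IH; case: (iter _ _ _) => [[x r] p]; exact: cg_inv_step.
Qed.

(** Pythagoras in the [A]-inner product: [A] maps the CG error to the residual, which is orthogonal
    to the Krylov space containing [cg A b k - y]. *)
Lemma cg_optimal k xs y : mv A xs = b -> krylov k y ->
  dot (vsub xs (cg A b k)) (mv A (vsub xs (cg A b k)))
  <= dot (vsub xs y) (mv A (vsub xs y)).
Proof.
move=> Axs Ky; have := cg_inv_iter k; rewrite /cg.
case: (iter _ _ _) => [[x r] p] /= [Kx rE _ _ orth _ _ _].
set e := vsub xs x; pose z := vsub x y.
have -> : vsub xs y = vadd e z by rewrite /e /z; vext.
have Ae : mv A e = r by rewrite mvB Axs rE.
have zr : dot z (mv A e) = 0 by rewrite Ae dotC; apply: orth; apply: krylovB.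
clearbody e z; rewrite mvD !(dotDl, dotDr) (symA e z) (dotC (mv A e) z) zr.
suff : 0 <= dot z (mv A z) by lra.
case: (Req_dec (dot z z) 0) => h; first by rewrite (dot_eq0 h) dot0l; lra.
by apply: Rlt_le; apply: posA => z0; apply: h; rewrite z0 dot0l.
Qed.

End ConjugateGradient.

(** * Chebyshev polynomials of an operator and the CG convergence rate *)

Section ChebyshevRecurrence.
Variables (d : nat) (A : mat d) (B : vec d -> vec d).
Local Notation ip u v := (dot u (mv A v)).
Implicit Types u v w : vec d.

(* [(T_k(B) v, U_(k-1)(B) v)] with Chebyshev polynomials of both kinds. *)
Fixpoint cheb v (k : nat) : vec d * vec d :=
  match k with
  | O => (v, vzero (d:=d))
  | k'.+1 => let: (t, u) := cheb v k' in
             (vsub (B t) (vsub u (B (B u))), vadd (B u) t)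
  end.

Hypothesis symA : msym A.
Hypotheses (linD : forall u v, B (vadd u v) = vadd (B u) (B v))
           (linB : forall u v, B (vsub u v) = vsub (B u) (B v))
           (adjB : forall u v, ip (B u) v = ip u (B v)).

Lemma ipC u v : ip u v = ip v u.
Proof. by rewrite symA dotC. Qed.

(* Pell's identity [T_k^2 + (1 - X^2) U_(k-1)^2 = 1]. *)
Lemma cheb_pell v k :
  ip (cheb v k).1 (cheb v k).1
  + ip (cheb v k).2 (vsub (cheb v k).2 (B (B (cheb v k).2))) = ip v v.
Proof.
elim: k => [|k IH] /=; first by rewrite dot0l; lra.
move: IH; case: (cheb v k) => t u /= <-.
rewrite !(linD, linB) !(mvD, mvB) !(dotDl, dotDr, dotBl, dotBr) !adjB.
(* The cross terms of the two squares cancel once [B] is moved across the form. *)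
have e1 : ip u (B t) = ip t (B u) by rewrite -adjB ipC.
have e3 : ip u (B (B (B t))) = ip t (B (B (B u)))
  by rewrite -(adjB u) -(adjB (B u)) -(adjB (B (B u))) ipC.
lra.
Qed.

(** The coupled recursion of [cheb] suits Pell's identity; this one is shared with the scalars that
    normalise the polynomials. *)
Lemma cheb_three_term v k :
  (cheb v k.+2).1 = vsub (vscale 2 (B (cheb v k.+1).1)) (cheb v k).1.
Proof.
move=> /=; case: (cheb v k) => t u /=.
by rewrite !(linD, linB); vext.
Qed.
End ChebyshevRecurrence.

Section Chebyshev.
Variables (d : nat) (A : mat d) (m L : R).
Hypotheses (symA : msym A) (m_gt0 : 0 < m) (m_lt_L : m < L).
Hypothesis specA : loewner_between m A L.
Implicit Types u v w x y : vec d.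

(* [A] rescaled so that its spectrum lies in [-1, 1]. *)
Definition rescaled u : vec d :=
  vsub (vscale ((L + m) / (L - m)) u) (vscale (2 / (L - m)) (mv A u)).
Local Notation B := rescaled.
Local Notation ip u v := (dot u (mv A v)).

Lemma rescaledD u v : B (vadd u v) = vadd (B u) (B v).
Proof. by rewrite /B mvD; vext. Qed.
Lemma rescaledB u v : B (vsub u v) = vsub (B u) (B v).
Proof. by rewrite /B mvB; vext. Qed.
Lemma rescaled_adj u v : ip (B u) v = ip u (B v).
Proof. by rewrite /B mvB !mvZ !dotBl !dotBr !dotZl !dotZr -symA. Qed.

(* With [P = A - m >= 0] and [Q = L - A >= 0] one has [1 - B^2 = c P Q] for some [c > 0];
   since [P + Q = L - m] is a scalar and [A = m + P], the product [A P Q] is a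
   nonnegative combination of [Q P Q] and [P Q P]. *)
Lemma rescaled_psd u : 0 <= ip u (vsub u (B (B u))).
Proof.
pose m0 := dot u u; pose m1 := dot u (mv A u); pose m2 := dot (mv A u) (mv A u).
pose m3 := dot (mv A u) (mv A (mv A u)).
have e1 : dot (mv A u) u = m1 by rewrite dotC.
have e2 : dot u (mv A (mv A u)) = m2 by rewrite symA.
have e3 : dot u (mv A (mv A (mv A u))) = m3 by rewrite symA.
have [_] := specA (vsub (mv A u) (vscale m u)).
have [+ _] := specA (vsub (vscale L u) (mv A u)).
rewrite /B !(mvB, mvZ) !(dotBl, dotBr, dotZl, dotZr) -/m0 -/m1 -/m2 -/m3 e1 e2 e3.
rewrite -/m1 -/m2 -/m3.
clearbody m0 m1 m2 m3; clear e1 e2 e3; move=> hY hZ.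
pose q := - L * m * m1 + (L + m) * m2 - m3.
(* [q] is the form of [A P Q]. As [(L - m) A = L P + m Q], the product [(L - m) q] is [L] times the
   form of [P Q P] (from [hZ]) plus [m] times that of [Q P Q] (from [hY]). *)
have q_ge0 : 0 <= (L - m) * q by rewrite /q; nra.
have -> : m1 - ((L + m) / (L - m) * ((L + m) / (L - m) * m1 - 2 / (L - m) * m2) -
   2 / (L - m) * ((L + m) / (L - m) * m2 - 2 / (L - m) * m3))
   = (L - m) * q * 4 * (/ (L - m)) ^ 3 by rewrite /q; field; lra.
apply: Rmult_le_pos; first by lra.
by apply: pow_le; apply: Rlt_le; apply: Rinv_0_lt_compat; lra.
Qed.

Lemma cheb_contract v k : ip (cheb B v k).1 (cheb B v k).1 <= ip v v.
Proof.
have := cheb_pell symA rescaledD rescaled_adj v k.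
by have := rescaled_psd (cheb B v k).2; lra.
Qed.

Variable rho : R.
Hypotheses (rho_gt0 : 0 < rho) (rhoE : (rho + / rho) / 2 = (L + m) / (L - m)).

(* The value [T_k((L + m) / (L - m))], which normalises [T_k(B)] to be [1] at [A = 0]. *)
Let c k := (rho ^ k + / rho ^ k) / 2.

(** As a polynomial in [A], [T_k(B)] has constant term [c k]; the remaining terms carry a factor
    [A], so on [xs] they give an element of the Krylov space of [A xs]. *)
Lemma cheb_krylov xs k :
  exists2 y, krylov A (mv A xs) k y & (cheb B xs k).1 = vsub (vscale (c k) xs) y.
Proof.
(* The three-term recurrence needs two consecutive indices in the induction. *)
suff [] : (exists2 y, krylov A (mv A xs) k y & (cheb B xs k).1 = vsub (vscale (c k) xs) y) /\
  (exists2 y, krylov A (mv A xs) k.+1 y & (cheb B xs k.+1).1 = vsub (vscale (c k.+1) xs) y)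
  by [].
elim: k => [|k [[y Ky yE] [y' Ky' y'E]]]; split.
- exists (vzero (d:=d)) => //=; rewrite /c /=.
  by apply: functional_extensionality => i; rewrite /vsub /vscale /vzero; field.
- exists (vscale (2 / (L - m)) (mv A xs)); first by apply: krylovZ; exact: krylov_rhs.
  have -> : c 1 = (L + m) / (L - m) by rewrite -rhoE /c pow_1.
  by rewrite /= /rescaled !(mv0, mvB, mvZ); vext.
- by exists y'.
- have -> : c k.+2 = 2 * ((L + m) / (L - m)) * c k.+1 - c k.
    rewrite -rhoE /c /=; field; split; last by lra.
    by apply: pow_nonzero; lra.
  rewrite (cheb_three_term rescaledD rescaledB) y'E yE.
  exists (vsub (vadd (vscale (4 * c k.+1 / (L - m)) (mv A xs)) (vscale 2 (B y'))) y).
    apply: krylovB; last by do 2 apply: krylovS.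
    apply: krylovD; first by apply: krylovZ; exact: krylov_rhs.
    apply: krylovZ; apply: krylovB; apply: krylovZ; first exact: krylovS.
    exact: krylov_mv.
  rewrite rescaledB; apply: functional_extensionality => i.
  by rewrite /B mvZ /vsub /vadd /vscale; field; lra.
Qed.

(** CG is compared with the Krylov vector [y / c k], whose error is [T_k(B) xs / c k]. [T_k(B)] does
    not increase the energy, and [c k >= / rho ^ k / 2]. *)
Lemma cg_energy_bound xs k :
  let e := vsub xs (cg A (mv A xs) k) in
  ip e e <= (2 * rho ^ k) ^ 2 * ip xs xs.
Proof.
move=> e.
have posA v : v <> vzero (d:=d) -> 0 < ip v v.
  move=> v0; have [h _] := specA v; have := dot_ge0 v.
  by case: (Req_dec (dot v v) 0) => [/dot_eq0 //|]; nra.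
have [y Ky yE] := cheb_krylov xs k.
have rk : 0 < rho ^ k by apply: pow_lt.
have rk' := Rinv_0_lt_compat _ rk.
have ck : 0 < c k by rewrite /c; lra.
have := cg_optimal symA posA (erefl (mv A xs)) (krylovZ (/ c k) Ky); rewrite -/e => opt.
have tE : vsub xs (vscale (/ c k) y) = vscale (/ c k) (cheb B xs k).1.
  by rewrite yE; apply: functional_extensionality => i; rewrite /vsub /vscale; field; lra.
rewrite tE mvZ dotZl dotZr in opt.
have con := cheb_contract xs k.
have ck_inv : / c k <= 2 * rho ^ k.
  have -> : 2 * rho ^ k = / (/ rho ^ k / 2) by field; lra.
  by apply: Rinv_le_contravar; rewrite /c; lra.
have ck_inv0 := Rinv_0_lt_compat _ ck.
have ipx : 0 <= ip xs xs by have [h _] := specA xs; have := dot_ge0 xs; nra.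
have sq : (/ c k) ^ 2 <= (2 * rho ^ k) ^ 2 by nra.
apply: Rle_trans opt _; rewrite -Rmult_assoc.
apply: Rle_trans (Rmult_le_compat_r _ _ _ ipx sq).
by have := Rmult_le_compat_l ((/ c k) ^ 2) _ _ (pow2_ge_0 _) con; lra.
Qed.

End Chebyshev.

(** Passing from the energy to the Euclidean norm costs [m] below and [L] above, hence the factor
    [sqrt (L / m)]. *)
Lemma cg_error_bound d (A : mat d) (m L : R) (xs : vec d) k :
  msym A -> 0 < m -> 1 < L / m -> loewner_between m A L ->
  vnorm (vsub xs (cg A (mv A xs) k))
  <= 2 * sqrt (L / m) * ((sqrt (L / m) - 1) / (sqrt (L / m) + 1)) ^ k * vnorm xs.
Proof.
move=> sA m0 d1 Am; set s := sqrt (L / m); set rho := (s - 1) / (s + 1).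
have Lm : L = L / m * m by field; lra.
have m_lt_L : m < L by rewrite Lm; nra.
have s1 : 1 < s by rewrite -sqrt_1; apply: sqrt_lt_1; lra.
have ss : s ^ 2 = L / m by rewrite /s /= Rmult_1_r sqrt_sqrt; lra.
have LE : L = s ^ 2 * m by rewrite ss.
have rho0 : 0 < rho by apply: Rdiv_lt_0_compat; lra.
(* With [L = s ^ 2 * m], both sides equal [(s ^ 2 + 1) / (s ^ 2 - 1)]. *)
have rhoE : (rho + / rho) / 2 = (L + m) / (L - m).
  rewrite LE /rho; field; repeat split; nra.
have := cg_energy_bound sA m0 m_lt_L Am rho0 rhoE xs k => /=.
set e := vsub _ _; have [lo _] := Am e; have [_ hi] := Am xs.
rewrite -!vnorm_sqr in lo hi => en.
have rk := pow_lt _ k rho0.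
apply: le_of_sqr_le.
  by have := vnorm_ge0 xs => h; do 2 (apply: Rmult_le_pos => //); lra.
have h2 := Rmult_le_compat_l _ _ _ (pow2_ge_0 (2 * rho ^ k)) hi.
apply: (Rmult_le_reg_l m) => //.
have -> : m * (2 * s * rho ^ k * vnorm xs) ^ 2
  = (2 * rho ^ k) ^ 2 * (s ^ 2 * m * vnorm xs ^ 2) by ring.
by rewrite -LE; lra.
Qed.

(** * Derivatives along lines, symmetry of the Hessian *)

Lemma derivable_pt_lim_of_little_o (f : R -> R) (t l K : R) : 0 <= K ->
  (forall eps, 0 < eps -> exists delta, 0 < delta /\ forall h, K * Rabs h < delta ->
     Rabs (f (t + h) - f t - h * l) <= eps * (K * Rabs h)) ->
  derivable_pt_lim f t l.
Proof.
move=> K0 fo eps eps0.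
(* [K] will involve the length of a direction and may be zero, so divisions are by [K + 1]. *)
have K1 : 0 < K + 1 by lra.
have eK : 0 < eps / (K + 1) by apply: Rdiv_lt_0_compat.
have [de [de0 H]] := fo _ eK.
have dK : 0 < de / (K + 1) by apply: Rdiv_lt_0_compat.
exists (mkposreal _ dK) => h h0 /= hd.
have ah := Rabs_pos_lt _ h0.
have hde : K * Rabs h < de.
  have := Rmult_lt_compat_l _ _ _ K1 hd.
  have -> : (K + 1) * (de / (K + 1)) = de by field; lra.
  lra.
have -> : (f (t + h) - f t) / h - l = (f (t + h) - f t - h * l) / h by field.
rewrite /Rdiv Rabs_mult Rabs_inv -/(Rdiv _ _).
apply: (Rmult_lt_reg_r (Rabs h)) => //.
have -> : forall x, x / Rabs h * Rabs h = x by move=> x; field; lra.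
apply: Rle_lt_trans (H h hde) _.
have -> : eps / (K + 1) * (K * Rabs h) = (eps * Rabs h) * (K / (K + 1)) by field; lra.
have k1 : K / (K + 1) < 1.
  by apply: (Rmult_lt_reg_r (K + 1)) => //; rewrite /Rdiv Rmult_assoc Rinv_l; lra.
have : 0 < eps * Rabs h by apply: Rmult_lt_0_compat.
nra.
Qed.

Section LineDerivatives.
Variable d : nat.
Implicit Types (u v w e : vec d).

Lemma line_shift w e t h :
  vadd w (vscale (t + h) e) = vadd (vadd w (vscale t e)) (vscale h e).
Proof. by vext. Qed.

Lemma gradient_line f (g : vec d -> vec d) w e t : is_gradient f g ->
  derivable_pt_lim (fun s => f (vadd w (vscale s e))) t (dot (g (vadd w (vscale t e))) e).
Proof.
move=> fg; apply: (derivable_pt_lim_of_little_o (vnorm_ge0 e)) => eps eps0.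
have [de [de0 H]] := fg (vadd w (vscale t e)) eps eps0.
exists de; split => // h; rewrite Rmult_comm -vnormZ line_shift => /H.
by rewrite dotZr.
Qed.

Lemma jacobian_line (g : vec d -> vec d) (H : vec d -> mat d) v w e t : is_jacobian g H ->
  derivable_pt_lim (fun s => dot v (g (vadd w (vscale s e)))) t
    (dot v (mv (H (vadd w (vscale t e))) e)).
Proof.
move=> gH; have v0 := vnorm_ge0 v; have e0 := vnorm_ge0 e.
have K0 : 0 <= vnorm v * vnorm e by apply: Rmult_le_pos.
(* This factor dominates [vnorm e], which controls the step length, and [vnorm v * vnorm e], which
   controls the error. *)
apply: (@derivable_pt_lim_of_little_o _ _ _ ((vnorm v + 1) * vnorm e)) => [|eps eps0].
  by apply: Rmult_le_pos; lra.
have [de [de0 gd]] := gH (vadd w (vscale t e)) eps eps0.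
exists de; split => // h hd.
have ah := Rabs_pos h.
have nh : vnorm (vscale h e) = Rabs h * vnorm e by rewrite vnormZ.
have he : 0 <= Rabs h * vnorm e by apply: Rmult_le_pos.
have := gd (vscale h e); rewrite nh line_shift => /(_ _).
set q := vsub _ _ => gde.
have {}gde : vnorm q <= eps * (Rabs h * vnorm e) by apply: gde; nra.
have -> : dot v (g (vadd (vadd w (vscale t e)) (vscale h e))) -
   dot v (g (vadd w (vscale t e))) - h * dot v (mv (H (vadd w (vscale t e))) e) = dot v q.
  by rewrite /q !dotBr mvZ dotZr.
have dq := dot_le_vnorm v q; have := dot_le_vnorm (vopp v) q; rewrite vnormN dotNl => dq'.
have vq := Rmult_le_compat_l _ _ _ v0 gde.
have eh : 0 <= eps * (Rabs h * vnorm e) by apply: Rmult_le_pos; lra.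
apply: Rabs_le; split; nra.
Qed.

Section Schwarz.
Variables (f : vec d -> R) (g : vec d -> vec d) (H : vec d -> mat d).
Hypotheses (fg : is_gradient f g) (gH : is_jacobian g H).

Let second_difference w u v t :=
  f (vadd (vadd w (vscale t u)) (vscale t v)) - f (vadd w (vscale t u))
  - f (vadd w (vscale t v)) + f w.

(** The second difference is the increment along [u] of [phi], a difference of [f] in direction [v].
    The mean value theorem turns it into gradients at two nearby points, and the expansion of [g] at
    [w] leaves [H w] applied to [t v]. *)
Lemma second_difference_lim w u v eps : 0 < eps -> exists delta, 0 < delta /\
  forall t, 0 < t < delta ->
  Rabs (second_difference w u v t - t ^ 2 * dot u (mv (H w) v)) <= eps * t ^ 2.
Proof.
move=> eps0; have u0 := vnorm_ge0 u; have v0 := vnorm_ge0 v.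
(* The displacements [h1] and [h2] have total length at most [t * (vnorm v + 2 * vnorm u)]; the last
   factor comes from pairing with [u]. *)
pose K := (vnorm v + 2 * vnorm u) * vnorm u.
have K0 : 0 <= K by apply: Rmult_le_pos; lra.
have eK : 0 < eps / (K + 1) by apply: Rdiv_lt_0_compat; lra.
have [de [de0 gd]] := gH w eK.
exists (de / (vnorm u + vnorm v + 1)); split; first by apply: Rdiv_lt_0_compat; lra.
move=> t [t0 td].
have {}td : t * (vnorm u + vnorm v + 1) < de.
  apply: (Rmult_lt_reg_r (/ (vnorm u + vnorm v + 1))).
    by apply: Rinv_0_lt_compat; lra.
  by rewrite Rmult_assoc Rinv_r; lra.
pose phi s := f (vadd (vadd w (vscale t v)) (vscale s u)) - f (vadd w (vscale s u)).
pose phi' s := dot (g (vadd (vadd w (vscale t v)) (vscale s u))) u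
               - dot (g (vadd w (vscale s u))) u.
have dphi c : 0 <= c <= t -> derivable_pt_lim phi c (phi' c).
  by move=> _; apply: derivable_pt_lim_minus; apply: gradient_line.
have [xi [phiE [xi0 xit]]] := MVT_cor2 phi phi' 0 t t0 dphi.
have -> : second_difference w u v t = t * phi' xi.
  transitivity (phi t - phi 0); last by rewrite phiE; ring.
  rewrite /phi /second_difference.
  have -> : vadd (vadd w (vscale t u)) (vscale t v) = vadd (vadd w (vscale t v)) (vscale t u)
    by vext.
  have -> : vadd (vadd w (vscale t v)) (vscale 0 u) = vadd w (vscale t v) by vext.
  have -> : vadd w (vscale 0 u) = w by vext.
  ring.
pose h1 := vadd (vscale t v) (vscale xi u); pose h2 := vscale xi u.
have n2 : vnorm h2 = xi * vnorm u by rewrite vnormZ Rabs_pos_eq; lra.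
have n1 : vnorm h1 <= t * vnorm v + xi * vnorm u.
  by apply: Rle_trans (vnormD _ _) _; rewrite !vnormZ !Rabs_pos_eq; lra.
have xu : xi * vnorm u <= t * vnorm u by nra.
have tv : 0 <= t * vnorm v by nra.
have tu : 0 <= t * vnorm u by nra.
have := gd h1 _ ; have := gd h2 _.
set q2 := vsub _ _ => /(_ _) r2; set q1 := vsub _ _ => /(_ _) r1.
have {}r2 : vnorm q2 <= eps / (K + 1) * vnorm h2 by apply: r2; lra.
have {}r1 : vnorm q1 <= eps / (K + 1) * vnorm h1 by apply: r1; lra.
have -> : t * phi' xi - t ^ 2 * dot u (mv (H w) v) = t * dot (vsub q1 q2) u.
  rewrite /phi' /q1 /q2 !dotBl.
  have -> : vadd (vadd w (vscale t v)) (vscale xi u) = vadd w h1 by rewrite /h1; vext.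
  rewrite -/h2 (_ : mv (H w) h1 = vadd (vscale t (mv (H w) v)) (mv (H w) h2)).
    by rewrite dotDl dotZl (dotC (mv (H w) v)); ring.
  by rewrite /h1 mvD mvZ.
have nq : vnorm (vsub q1 q2) <= eps / (K + 1) * (t * (vnorm v + 2 * vnorm u)).
  have -> : vsub q1 q2 = vadd q1 (vopp q2) by vext.
  apply: Rle_trans (vnormD _ _) _; rewrite vnormN; nra.
have e0 := Rlt_le _ _ eK.
have dq : Rabs (dot (vsub q1 q2) u) <= eps / (K + 1) * (t * (vnorm v + 2 * vnorm u)) * vnorm u.
  have h := Rmult_le_compat_r _ _ _ u0 nq.
  have := dot_le_vnorm (vsub q1 q2) u; have := dot_le_vnorm (vopp (vsub q1 q2)) u.
  rewrite vnormN dotNl => *; apply: Rabs_le; lra.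
rewrite Rabs_mult (Rabs_pos_eq t); last by lra.
have K1 : eps / (K + 1) * K <= eps.
  have -> : eps / (K + 1) * K = eps - eps / (K + 1) by field; lra.
  lra.
have := Rmult_le_compat_l _ _ _ (Rlt_le _ _ t0) dq.
have -> : t * (eps / (K + 1) * (t * (vnorm v + 2 * vnorm u)) * vnorm u)
  = t ^ 2 * (eps / (K + 1) * K) by rewrite /K; ring.
have t2 : 0 < t ^ 2 by nra.
nra.
Qed.

(** The second difference is symmetric in [u] and [v], so both bilinear values are its limit after
    division by [t ^ 2]. *)
Lemma hessian_sym w : msym (H w).
Proof.
move=> u v; rewrite (dotC _ v).
apply: cond_eq => eps eps0.
have e4 : 0 < eps / 4 by lra.
have [d1 [d10 H1]] := second_difference_lim w u v e4.
have [d2 [d20 H2]] := second_difference_lim w v u e4.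
pose t := Rmin d1 d2 / 2.
have tm : 0 < t by rewrite /t; have := Rmin_glb_lt _ _ _ d10 d20; lra.
have t1 : t < d1 by have := Rmin_l d1 d2; rewrite /t in tm *; lra.
have t2 : t < d2 by have := Rmin_r d1 d2; rewrite /t in tm *; lra.
have := H1 t (conj tm t1); have := H2 t (conj tm t2).
have -> : second_difference w v u t = second_difference w u v t.
  rewrite /second_difference.
  have -> : vadd (vadd w (vscale t u)) (vscale t v) = vadd (vadd w (vscale t v)) (vscale t u)
    by vext.
  ring.
move: (second_difference _ _ _ _) (dot u _) (dot v _) => D a b.
have tt : 0 < t ^ 2 by nra.
move=> h1 h2; apply: (Rmult_lt_reg_l (t ^ 2)) => //.
rewrite -{1}(Rabs_pos_eq (t ^ 2)) -?Rabs_mult; last by lra.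
have -> : t ^ 2 * (a - b) = (D - t ^ 2 * b) - (D - t ^ 2 * a) by ring.
apply: Rle_lt_trans (Rabs_triang _ _) _; rewrite Rabs_Ropp; nra.
Qed.
End Schwarz.

(** Subtracting the primitive [K * (t - t ^ 2 / 2)] of the bound leaves a function with nonpositive
    derivative on [0, 1]; this yields the factor 1/2 without an integral. *)
Lemma mvt_decay (phi phi' : R -> R) K :
  (forall t, derivable_pt_lim phi t (phi' t)) ->
  (forall t, 0 <= t <= 1 -> phi' t <= K * (1 - t)) ->
  phi 1 - phi 0 <= K / 2.
Proof.
move=> dphi hK.
pose chi t := phi t - K * (t - t ^ 2 / 2).
pose chi' t := phi' t - K * (1 - t).
have dchi c : 0 <= c <= 1 -> derivable_pt_lim chi c (chi' c).
  move=> _; apply: derivable_pt_lim_minus => //.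
  apply: (@derivable_pt_lim_scal (fun t => t - t ^ 2 / 2) K c (1 - c)).
  apply: derivable_pt_lim_minus; first exact: derivable_pt_lim_id.
  have -> : (fun t => t ^ 2 / 2) = (fun t => / 2 * t ^ 2).
    by apply: functional_extensionality => t; field.
  have e : c = / 2 * (INR 2 * c ^ Init.Nat.pred 2) by rewrite /=; field.
  rewrite [X in derivable_pt_lim _ _ X]e.
  exact: (@derivable_pt_lim_scal (fun t => t ^ 2) _ _ _ (derivable_pt_lim_pow c 2)).
have [c [chiE c01]] := MVT_cor2 chi chi' 0 1 Rlt_0_1 dchi.
by have := hK c _; rewrite /chi /chi' in chiE; lra.
Qed.

(** * Taylor remainder, Lipschitz gradient and stationarity *)

Section Taylor.
Variables (g : vec d -> vec d) (H : vec d -> mat d).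
Hypothesis gH : forall v w e t,
  derivable_pt_lim (fun s => dot v (g (vadd w (vscale s e)))) t
    (dot v (mv (H (vadd w (vscale t e))) e)).

Lemma newton_remainder M w z : 0 <= M ->
  (forall x y, opnorm_le (msub (H x) (H y)) (M * vnorm (vsub x y))) ->
  vnorm (vsub (mv (H w) (vsub w z)) (vsub (g w) (g z))) <= M / 2 * vnorm (vsub w z) ^ 2.
Proof.
move=> M0 lipH; set e := vsub w z; have e0 := vnorm_ge0 e.
have e2 := pow2_ge_0 (vnorm e).
apply: vnorm_le_dual => [|v]; first by apply: Rmult_le_pos; lra.
have v0 := vnorm_ge0 v.
(* The segment runs from [z] to [w], so its point at [t] is [(1 - t) e] away from [w]; Lipschitz
   continuity then gives the decay that [mvt_decay] asks for. *)
pose phi t := t * dot v (mv (H w) e) - dot v (g (vadd z (vscale t e))).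
pose phi' t := 1 * dot v (mv (H w) e) - dot v (mv (H (vadd z (vscale t e))) e).
have dphi t : derivable_pt_lim phi t (phi' t).
  apply: derivable_pt_lim_minus => //.
  have -> : 1 * dot v (mv (H w) e) = 1 * dot v (mv (H w) e) + t * 0 by ring.
  exact: derivable_pt_lim_mult (derivable_pt_lim_id t) (derivable_pt_lim_const _ t).
have := @mvt_decay phi phi' (M * vnorm e ^ 2 * vnorm v) dphi _.
rewrite {1}/phi {1}/phi.
have -> : vadd z (vscale 1 e) = w by rewrite /e; vext.
have -> : vadd z (vscale 0 e) = z by vext.
rewrite !dotBr => h.
suff : forall t, 0 <= t <= 1 -> phi' t <= M * vnorm e ^ 2 * vnorm v * (1 - t).
  by move=> /h; lra.
move=> t t01; rewrite /phi' Rmult_1_l -dotBr -mv_msub.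
have wz : vsub w (vadd z (vscale t e)) = vscale (1 - t) e by rewrite /e; vext.
have := lipH w (vadd z (vscale t e)) e; rewrite wz vnormZ Rabs_pos_eq; last by lra.
move=> hl; apply: Rle_trans (dot_le_vnorm _ _) _.
have := Rmult_le_compat_l _ _ _ v0 hl; lra.
Qed.

Lemma gradient_lipschitz m L w z : 0 <= m -> 0 <= L -> (forall x, msym (H x)) ->
  (forall x, loewner_between m (H x) L) ->
  vnorm (vsub (g w) (g z)) <= L * vnorm (vsub w z).
Proof.
move=> m0 L0 sH bH; set e := vsub w z; have e0 := vnorm_ge0 e.
apply: vnorm_le_dual => [|v]; first exact: Rmult_le_pos.
have [c [hc _]] := MVT_cor2 _ _ 0 1 Rlt_0_1 (fun t _ => gH v z e t).
move: hc.
have -> : vadd z (vscale 1 e) = w by rewrite /e; vext.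
have -> : vadd z (vscale 0 e) = z by vext.
rewrite dotBr => ->.
have b0 : loewner_between 0 (H (vadd z (vscale c e))) L.
  move=> x; have [h1 h2] := bH (vadd z (vscale c e)) x; split => //.
  by have := dot_ge0 x; nra.
by have := sym_form_le v e (sH _) b0 L0; lra.
Qed.
End Taylor.

(** Along the direction [g w] itself, the derivative at the minimum is the squared norm of [g w]. *)
Lemma gradient_eq0 (f : vec d -> R) (g : vec d -> vec d) w :
  (forall e t, derivable_pt_lim (fun s => f (vadd w (vscale s e))) t
     (dot (g (vadd w (vscale t e))) e)) ->
  (forall z, f w <= f z) -> g w = vzero (d:=d).
Proof.
move=> fg fmin; apply: dot_eq0.
have w0 e : vadd w (vscale 0 e) = w by vext.
have dg := fg (g w) 0; rewrite w0 in dg.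
have pr : derivable_pt (fun s => f (vadd w (vscale s (g w)))) 0 by exists (dot (g w) (g w)).
rewrite -(@derive_pt_eq_0 _ _ _ pr dg).
by apply: (@deriv_minimum _ (-1) 1) => [||x _ _]; [lra|lra|rewrite w0].
Qed.

End LineDerivatives.

(** * Averages over samples *)

Section Averages.
Variable T : finType.
Implicit Types f g : T -> R.

Lemma avgTD f g : avgT (fun t => f t + g t) = avgT f + avgT g.
Proof. by rewrite /avgT big_split /=; rewrite /Rdiv; ring. Qed.
Lemma avgTZ a f : avgT (fun t => a * f t) = a * avgT f.
Proof. by rewrite /avgT -big_distrr /= /Rdiv; ring. Qed.
Lemma avgT_ext f g : (forall t, f t = g t) -> avgT f = avgT g.
Proof. by move=> fg; rewrite /avgT; congr (_ / _); apply: eq_bigr => t _. Qed.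
Lemma avgT_le f g : (forall t, f t <= g t) -> avgT f <= avgT g.
Proof.
move=> fg; rewrite /avgT /Rdiv.
(* Over an empty type both averages are 0, since [/ 0 = 0]. *)
case: (posnP #|T|) => [->|T0]; first by rewrite /= Rinv_0; lra.
apply: Rmult_le_compat_r.
  by apply: Rlt_le; apply: Rinv_0_lt_compat; apply: lt_0_INR; apply/ltP.
apply: (big_ind2 (fun x y => x <= y)) => [|x1 x2 y1 y2 h1 h2|t _ //]; lra.
Qed.
Lemma avgT_const a : (0 < #|T|)%nat -> avgT (fun _ : T => a) = a.
Proof.
move=> T0; rewrite /avgT big_const.
have TR : INR #|T| <> 0 by apply: not_0_INR => h; rewrite h in T0.
suff -> : iter #|T| (Rplus a) 0 = a * INR #|T| by field.
by elim: #|T| => [|n IH]; rewrite ?iterS ?IH ?S_INR /=; ring.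
Qed.

Lemma avgT_sqr_le f c : 0 <= c -> (0 < #|T|)%nat ->
  avgT (fun t => f t ^ 2) <= c ^ 2 -> avgT f <= c.
Proof.
move=> c0 T0 h; apply: le_of_sqr_le => //; apply: Rle_trans h.
set m := avgT f.
(* Nonnegativity of the variance of [f]. *)
have : avgT (fun _ : T => 0) <= avgT (fun t => f t ^ 2 + (- (2 * m) * f t + m ^ 2)).
  by apply: avgT_le => t; have := pow2_ge_0 (f t - m); lra.
rewrite avgTD avgTD avgTZ !avgT_const // -/m; lra.
Qed.

(** Fubini for independent uniform draws: condition on the first [n] and average over the newest,
    which is appended on the right, where [foldl] consumes it last. *)
Lemma avgT_rcons n (f : seq T -> R) :
  avgT (fun t : n.+1.-tuple T => f t)
  = avgT (fun t : n.-tuple T => avgT (fun x => f (rcons t x))).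
Proof.
pose h (p : n.-tuple T * T) : n.+1.-tuple T := [tuple of rcons p.1 p.2].
have hinj : injective h.
  move=> [t x] [t' x'] /(congr1 val) /= /rcons_inj [tt' ->].
  by congr (_, _); apply: val_inj.
have hbij : bijective h.
  by apply: inj_card_bij hinj _; rewrite card_prod !card_tuple expnSr.
rewrite /avgT (reindex h) /=; last exact: onW_bij.
rewrite -(pair_bigA _ (fun t x => f (rcons (tval t) x))) /=.
rewrite /Rdiv -big_distrl /= !card_tuple expnSr -multE mult_INR Rinv_mult Rmult_assoc.
by congr (_ * _); exact: Rmult_comm.
Qed.

End Averages.

Section SampleVariance.
Variables (d : nat) (T : finType) (x : T -> vec d).
Hypothesis T0 : (0 < #|T|)%nat.
Hypothesis centered : forall u, avgT (fun t => dot u (x t)) = 0.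

Definition vsum (s : seq T) : vec d := fun k => \big[Rplus/0]_(i <- s) x i k.

(** A new draw is centered and independent of the previous ones, so its cross term with their sum
    averages to zero. *)
Lemma sample_variance n :
  avgT (fun t : n.-tuple T => dot (vsum t) (vsum t)) = INR n * avgT (fun i => dot (x i) (x i)).
Proof.
elim: n => [|n IH].
  rewrite (avgT_ext (g := fun _ => 0)).
    by rewrite avgT_const ?card_tuple //=; ring.
  move=> t; rewrite (tuple0 t) /=.
  have -> : vsum [::] = vzero (d:=d).
    by apply: functional_extensionality => k; rewrite /vsum big_nil.
  exact: dot0l.
rewrite (avgT_rcons n (fun s => dot (vsum s) (vsum s))).
pose V := avgT (fun i => dot (x i) (x i)).
rewrite (avgT_ext (g := fun t : n.-tuple T => dot (vsum t) (vsum t) + V)).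
  rewrite avgTD IH avgT_const ?card_tuple ?expn_gt0 ?T0 // S_INR /V; ring.
move=> t.
rewrite (avgT_ext (g := fun i => dot (vsum t) (vsum t) +
   (2 * dot (vsum t) (x i) + dot (x i) (x i)))).
  by rewrite !avgTD avgTZ centered avgT_const // -/V; ring.
move=> i; have -> : vsum (rcons t i) = vadd (vsum t) (x i).
  by apply: functional_extensionality => k; rewrite /vsum /vadd -cats1 big_cat big_seq1.
by rewrite !(dotDl, dotDr) (dotC (x i)); ring.
Qed.
End SampleVariance.

(** * Finite sums and the deviation of the subsampled Hessian *)

Section FiniteSums.
Variables (d N : nat).
Implicit Types (u v w e : vec d) (S : seq 'I_N).

Lemma dot_sum (I : Type) (s : seq I) (P : pred I) (x : I -> vec d) a u :
  dot u (fun k => a * \big[Rplus/0]_(i <- s | P i) x i k)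
  = a * \big[Rplus/0]_(i <- s | P i) dot u (x i).
Proof.
rewrite /dot exchange_big big_distrr /=; apply: eq_bigr => k _.
by rewrite -big_distrr /=; ring.
Qed.

Lemma mv_sum (I : Type) (s : seq I) (P : pred I) (X : I -> mat d) a v :
  mv (fun k l => a * \big[Rplus/0]_(i <- s | P i) X i k l) v
  = (fun k => a * \big[Rplus/0]_(i <- s | P i) mv (X i) v k).
Proof.
apply: functional_extensionality => k; rewrite /mv exchange_big big_distrr /=.
by apply: eq_bigr => l _; rewrite -big_distrl /=; ring.
Qed.

Lemma msym_sum (I : Type) (s : seq I) (P : pred I) (X : I -> mat d) a :
  (forall i, msym (X i)) -> msym (fun k l => a * \big[Rplus/0]_(i <- s | P i) X i k l).
Proof.
move=> sX u v; rewrite (dotC (mv _ u)) !mv_sum !dot_sum; congr (_ * _).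
by apply: eq_bigr => i _; rewrite sX dotC.
Qed.

Lemma avgT_ord (f : 'I_N -> R) : avgT f = / INR N * \big[Rplus/0]_(i < N) f i.
Proof. by rewrite /avgT card_ord /Rdiv Rmult_comm. Qed.

Lemma derivable_pt_lim_sum (I : Type) (s : seq I) (f : I -> R -> R) (l : I -> R) t a :
  (forall i, derivable_pt_lim (f i) t (l i)) ->
  derivable_pt_lim (fun x => a * \big[Rplus/0]_(i <- s) f i x) t
    (a * \big[Rplus/0]_(i <- s) l i).
Proof.
move=> fl; apply: (@derivable_pt_lim_scal (fun x => \big[Rplus/0]_(i <- s) f i x)).
elim: s => [|i s IH].
  rewrite big_nil (_ : (fun _ => _) = fun=> 0); first exact: derivable_pt_lim_const.
  by apply: functional_extensionality => x; rewrite big_nil.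
rewrite big_cons (_ : (fun _ => _) = fun x => f i x + \big[Rplus/0]_(j <- s) f j x).
  exact: derivable_pt_lim_plus.
by apply: functional_extensionality => x; rewrite big_cons.
Qed.

Lemma Rfun_line (F : 'I_N -> vec d -> R) gF w e t : (forall i, is_gradient (F i) (gF i)) ->
  derivable_pt_lim (fun s => Rfun F (vadd w (vscale s e))) t
    (dot (gradR gF (vadd w (vscale t e))) e).
Proof.
move=> Fg; rewrite dotC /gradR dot_sum; apply: derivable_pt_lim_sum => i.
by rewrite dotC; apply: gradient_line.
Qed.

Lemma gradR_line gF HF v w e t : (forall i : 'I_N, is_jacobian (gF i) (HF i)) ->
  derivable_pt_lim (fun s => dot v (gradR gF (vadd w (vscale s e)))) t
    (dot v (mv (hessR HF (vadd w (vscale t e))) e)).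
Proof.
move=> gH; rewrite /hessR mv_sum dot_sum.
rewrite (_ : (fun _ => _) =
  fun s => / INR N * \big[Rplus/0]_(i < N) dot v (gF i (vadd w (vscale s e)))).
  by apply: derivable_pt_lim_sum => i; apply: jacobian_line.
by apply: functional_extensionality => s; rewrite /gradR dot_sum.
Qed.

Lemma hessS_deviation HF (beta : nat) w sigma v :
  (0 < N)%nat -> (0 < beta)%nat -> (forall i : 'I_N, msym (HF i w)) ->
  opnorm_le (hess_var HF w) (sigma ^ 2) ->
  avgT (fun S : beta.-tuple 'I_N =>
    vnorm (mv (msub (hessS HF S w) (hessR HF w)) v) ^ 2)
  <= sigma ^ 2 / INR beta * vnorm v ^ 2.
Proof.
move=> N0 b0 sH var.
pose x i := mv (msub (HF i w) (hessR HF w)) v.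
have bR : 0 < INR beta by apply: lt_0_INR; apply/ltP.
have NR : 0 < INR N by apply: lt_0_INR; apply/ltP.
have T0 : (0 < #|'I_N|)%nat by rewrite card_ord.
have sR : msym (hessR HF w) by apply: msym_sum.
have sD i : msym (msub (HF i w) (hessR HF w)).
  by move=> a c; rewrite !mv_msub dotBr dotBl sH sR.
have cen u : avgT (fun i => dot u (x i)) = 0.
  rewrite (avgT_ext (g := fun i => dot u (mv (HF i w) v) + -1 * dot u (mv (hessR HF w) v))).
    have -> : dot u (mv (hessR HF w) v) = avgT (fun i => dot u (mv (HF i w) v)).
      by rewrite avgT_ord /hessR mv_sum dot_sum.
    by rewrite avgTD avgT_const //; ring.
  by move=> i; rewrite /x mv_msub dotBr; ring.
(* Symmetry of each deviation [D] rewrites the squared norm of [D v] as the form of [D ^ 2] at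
   [v]. *)
have varE : avgT (fun i => dot (x i) (x i)) = dot v (mv (hess_var HF w) v).
  rewrite /hess_var mv_sum dot_sum avgT_ord; congr (_ * _); apply: eq_bigr => i _.
  by rewrite mv_mmul sD.
have SE (S : beta.-tuple 'I_N) :
    mv (msub (hessS HF S w) (hessR HF w)) v = vscale (/ INR beta) (vsum x S).
  rewrite mv_msub /hessS size_tuple mv_sum; apply: functional_extensionality => k.
  rewrite /vsub /vscale /vsum.
  have -> : \big[Rplus/0]_(i <- S) x i k
      = \big[Rplus/0]_(i <- S) (mv (HF i w) v k + - mv (hessR HF w) v k).
    by apply: eq_bigr => i _; rewrite /x mv_msub.
  rewrite big_split /= big_const_seq count_predT size_tuple.
  suff -> : iter beta (Rplus (- mv (hessR HF w) v k)) 0 = - mv (hessR HF w) v k * INR beta.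
    by rewrite Rmult_plus_distr_l; congr (_ + _); field; lra.
  by elim: beta {b0 bR S} => [|n IH]; rewrite ?iterS ?IH ?S_INR /=; ring.
rewrite (avgT_ext (g := fun S : beta.-tuple 'I_N =>
   (/ INR beta) ^ 2 * dot (vsum x S) (vsum x S))); last first.
  by move=> S; rewrite SE vnorm_sqr dotZl dotZr; ring.
rewrite avgTZ sample_variance // varE.
have -> : forall a, (/ INR beta) ^ 2 * (INR beta * a) = / INR beta * a by move=> a; field; lra.
have -> : sigma ^ 2 / INR beta * vnorm v ^ 2 = / INR beta * (sigma ^ 2 * vnorm v ^ 2)
  by field; lra.
apply: Rmult_le_compat_l; first by apply: Rlt_le; apply: Rinv_0_lt_compat.
apply: Rle_trans (dot_le_vnorm _ _) _.
have := Rmult_le_compat_l _ _ _ (vnorm_ge0 v) (var v); lra.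
Qed.

End FiniteSums.

(** The CG contraction factor is [/ q], and exponentiating the hypothesis gives [q ^ r >= c * s]. *)
Lemma cg_factor_le (c s : R) (r : nat) : 1 < s -> 0 < c ->
  ln (c * s) / ln ((s + 1) / (s - 1)) <= INR r ->
  2 * s * ((s - 1) / (s + 1)) ^ r <= 2 / c.
Proof.
move=> s1 c0; set q := (s + 1) / (s - 1) => hr.
have q1 : 1 < q.
  have -> : q = 1 + 2 / (s - 1) by rewrite /q; field; lra.
  by have : 0 < 2 / (s - 1) by [apply: Rdiv_lt_0_compat; lra]; lra.
have lq : 0 < ln q by rewrite -ln_1; apply: ln_increasing; lra.
have cs : 0 < c * s by apply: Rmult_lt_0_compat; lra.
have {}hr : ln (c * s) <= INR r * ln q.
  have := Rmult_le_compat_r _ _ _ (Rlt_le _ _ lq) hr.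
  by rewrite /Rdiv Rmult_assoc Rinv_l; lra.
have qr : 0 < q ^ r by apply: pow_lt; lra.
rewrite -ln_pow in hr; last by lra.
have {}hr : c * s <= q ^ r.
  by case: (Rle_lt_dec (c * s) (q ^ r)) => // h; have := ln_increasing _ _ qr h; lra.
have -> : (s - 1) / (s + 1) = / q by rewrite /q; field; lra.
rewrite pow_inv.
have -> : 2 * s * / q ^ r = 2 / c * ((c * s) * / q ^ r) by field; lra.
have c2 : 0 < 2 / c by apply: Rdiv_lt_0_compat; lra.
have : (c * s) * / q ^ r <= 1.
  by apply: (Rmult_le_reg_r (q ^ r)) => //; rewrite Rmult_assoc Rinv_l; lra.
nra.
Qed.

(** * The inexact Newton step *)

Lemma inexact_newton_step d (A H : mat d) (g e : vec d) (m L l c : R) (r : nat) :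
  msym A -> 0 < m -> 1 < L / m -> loewner_between m A L -> 0 < l ->
  vnorm g <= l * vnorm e ->
  vnorm (vsub (mv H e) g) <= c * vnorm e ^ 2 ->
  ln (16 * l / m * sqrt (L / m)) /
    ln ((sqrt (L / m) + 1) / (sqrt (L / m) - 1)) <= INR r ->
  vnorm (vadd e (cg A (vopp g) r))
  <= c / m * vnorm e ^ 2 + / m * vnorm (mv (msub A H) e) + 1 / 8 * vnorm e.
Proof.
move=> sA m0 d1 Am l0 gl gH hr.
have [xs Axs] := coercive_surj m0 Am (vopp g).
have im := Rinv_0_lt_compat _ m0.
have s1 : 1 < sqrt (L / m) by rewrite -sqrt_1; apply: sqrt_lt_1; lra.
have C0 : 0 < 16 * l / m by apply: Rdiv_lt_0_compat; lra.
have fac := cg_factor_le s1 C0 hr.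
have := cg_error_bound xs r sA m0 d1 Am; rewrite Axs => err.
have xsn : m * vnorm xs <= l * vnorm e.
  by apply: Rle_trans (coercive_vnorm xs Am) _; rewrite Axs vnormN.
(* With [c = 16 l / m] the CG factor is at most [m / (8 l)], while [xs] has norm at most [l / m]
   times that of [e]. *)
have {}err : vnorm (vsub xs (cg A (vopp g) r)) <= 1 / 8 * vnorm e.
  apply: Rle_trans err _.
  apply: Rle_trans (Rmult_le_compat_r _ _ _ (vnorm_ge0 xs) fac) _.
  have -> : 2 / (16 * l / m) * vnorm xs = / (8 * l) * (m * vnorm xs) by field; lra.
  have -> : 1 / 8 * vnorm e = / (8 * l) * (l * vnorm e) by field; lra.
  by apply: Rmult_le_compat_l => //; apply: Rlt_le; apply: Rinv_0_lt_compat; lra.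
have newton : vnorm (vadd e xs) <= / m * (vnorm (mv (msub A H) e) + c * vnorm e ^ 2).
  apply: (Rmult_le_reg_l m) => //; rewrite -Rmult_assoc Rinv_r ?Rmult_1_l; last by lra.
  apply: Rle_trans (coercive_vnorm (vadd e xs) Am) _.
  have -> : mv A (vadd e xs) = vadd (mv (msub A H) e) (vsub (mv H e) g).
    by rewrite mvD Axs mv_msub; vext.
  apply: Rle_trans (vnormD _ _) _; lra.
have -> : vadd e (cg A (vopp g) r) = vadd (vadd e xs) (vopp (vsub xs (cg A (vopp g) r)))
  by vext.
apply: Rle_trans (vnormD _ _) _; rewrite vnormN /Rdiv; lra.
Qed.

Theorem theorem3p2 (d N : nat)
  (F : 'I_N -> vec d -> R) (gF : 'I_N -> vec d -> vec d) (HF : 'I_N -> vec d -> mat d)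
  (mu_ L_ : nat -> R) (mubar Lbar mu L M sigma gamma : R)
  (wstar w0 : vec d) (beta r : nat) :
  (0 < N)%nat ->
  (* each F_i is twice continuously differentiable, with gradient gF i and Hessian HF i *)
  (forall i, is_gradient (F i) (gF i)) ->
  (forall i, is_jacobian (gF i) (HF i)) ->
  (forall i, mat_continuous (HF i)) ->
  (* Assumption A1 *)
  (forall b : nat, (0 < b)%nat ->
     0 < mu_ b /\ mu_ b <= L_ b /\
     (forall (S : seq 'I_N) (w : vec d), size S = b ->
        loewner_between (mu_ b) (hessS HF S w) (L_ b))) ->
  0 < mubar ->
  (forall b : nat, (0 < b)%nat -> mubar <= mu_ b /\ L_ b <= Lbar) ->
  0 < mu -> mu <= L ->
  (forall w : vec d, loewner_between mu (hessR HF w) L) ->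
  (* Assumption A3 *)
  0 < M ->
  (forall w z : vec d, opnorm_le (msub (hessR HF w) (hessR HF z)) (M * vnorm (vsub w z))) ->
  (* Assumption A4 *)
  (forall w : vec d, opnorm_le (hess_var HF w) (sigma ^ 2)) ->
  (* w* is the unique minimizer of R *)
  is_unique_minimizer (Rfun F) wstar ->
  (* Assumption B1 *)
  0 < gamma ->
  (forall k : nat,
     expect_iter gF HF beta r w0 k (fun w => vnorm (vsub w wstar) ^ 2)
     <= gamma * (expect_iter gF HF beta r w0 k (fun w => vnorm (vsub w wstar))) ^ 2) ->
  (* sample size, condition number, and number of CG iterations *)
  (0 < beta)%nat ->
  64 * sigma ^ 2 / mubar ^ 2 <= INR beta ->
  1 < L_ beta / mu_ beta ->
  ln (16 * L / mu_ beta * sqrt (L_ beta / mu_ beta)) /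
    ln ((sqrt (L_ beta / mu_ beta) + 1) / (sqrt (L_ beta / mu_ beta) - 1)) <= INR r ->
  (* initial point *)
  vnorm (vsub w0 wstar) <=
    Rmin (1 / (4 * (M / (2 * mu_ beta)))) (1 / (4 * gamma * (M / (2 * mu_ beta)))) ->
  forall k : nat,
    expect_iter gF HF beta r w0 k.+1 (fun w => vnorm (vsub w wstar))
    <= 1 / 2 * expect_iter gF HF beta r w0 k (fun w => vnorm (vsub w wstar)).
Proof.
move=> N0 Fg gH _ A1 mubar0 A1bar mu0 muL hR M0 A3 A4 [wmin _] gamma0 B1 beta0
  hbeta delta1 hr hw0.
have [m0 [_ hS]] := A1 beta beta0; have [mbar _] := A1bar beta beta0.
set m := mu_ beta in m0 hS mbar delta1 hr hw0.
have L0 : 0 < L by lra.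
have im := Rinv_0_lt_compat _ m0.
have bR : 0 < INR beta by apply: lt_0_INR; apply/ltP.
have symH i w : msym (HF i w) := hessian_sym (Fg i) (gH i) w.
have symR w : msym (hessR HF w) by apply: msym_sum.
have gline v w e t := gradR_line v w e t gH.
have gs0 : gradR gF wstar = vzero (d:=d).
  by apply: (gradient_eq0 (f := Rfun F)) => // e t; apply: Rfun_line.
pose err w := vnorm (vsub w wstar); pose C := M / (2 * m).
have C0 : 0 < C by apply: Rdiv_lt_0_compat; lra.
have step w (S : beta.-tuple 'I_N) : err (newton_cg_step gF HF r w S) <=
    C * err w ^ 2 + / m * vnorm (mv (msub (hessS HF S w) (hessR HF w)) (vsub w wstar))
    + 1 / 8 * err w.
  have gB : vsub (gradR gF w) (gradR gF wstar) = gradR gF w by rewrite gs0; vext.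
  have gl := gradient_lipschitz gline w wstar (Rlt_le _ _ mu0) (Rlt_le _ _ L0) symR hR.
  have gr := newton_remainder gline w wstar (Rlt_le _ _ M0) A3.
  rewrite gB in gl gr.
  have sS : msym (hessS HF S w) by apply: msym_sum.
  have := inexact_newton_step sS m0 delta1 (hS S w (size_tuple S)) L0 gl gr hr.
  have -> : M / 2 / m = C by rewrite /C; field; lra.
  rewrite /err /newton_cg_step.
  set q := cg _ _ _.
  by have -> : vsub (vadd w q) wstar = vadd (vsub w wstar) q by vext.
have dev w : avgT (fun S : beta.-tuple 'I_N =>
    vnorm (mv (msub (hessS HF S w) (hessR HF w)) (vsub w wstar))) <= m / 8 * err w.
  have e0 : 0 <= err w := vnorm_ge0 _.
  apply: avgT_sqr_le; first by apply: Rmult_le_pos; lra.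
    by rewrite card_tuple card_ord expn_gt0 N0.
  apply: Rle_trans (hessS_deviation _ N0 beta0 _ (A4 w)) _ => //; rewrite -/(err w).
  have -> : (m / 8 * err w) ^ 2 = m ^ 2 / 64 * err w ^ 2 by field.
  (* The sample size gives [64 sigma ^ 2 <= beta * mubar ^ 2 <= beta * m ^ 2]. *)
  apply: Rmult_le_compat_r; first exact: pow2_ge_0.
  apply: (Rmult_le_reg_r (INR beta)) => //.
  have -> : sigma ^ 2 / INR beta * INR beta = sigma ^ 2 by field; lra.
  have mb2 : 0 < mubar ^ 2 by nra.
  have := Rmult_le_compat_r _ _ _ (Rlt_le _ _ mb2) hbeta.
  have -> : 64 * sigma ^ 2 / mubar ^ 2 * mubar ^ 2 = 64 * sigma ^ 2 by field; lra.
  have : mubar ^ 2 <= m ^ 2 by nra.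
  nra.
pose E k := expect_iter gF HF beta r w0 k err.
have Tn0 k : (0 < #|{: k.-tuple (beta.-tuple 'I_N)}|)%nat.
  by rewrite !card_tuple card_ord !expn_gt0 N0.
have T0 : (0 < #|{: beta.-tuple 'I_N}|)%nat by rewrite card_tuple card_ord expn_gt0 N0.
have E_ge0 k : 0 <= E k.
  rewrite -(avgT_const 0 (Tn0 k)); apply: avgT_le => t; exact: vnorm_ge0.
have rec k : E k.+1 <= C * (gamma * E k ^ 2) + 1 / 4 * E k.
  apply: Rle_trans (_ : C * expect_iter gF HF beta r w0 k (fun w => err w ^ 2)
    + 1 / 4 * E k <= _); last first.
    have hB : expect_iter gF HF beta r w0 k (fun w => err w ^ 2) <= gamma * E k ^ 2 := B1 k.
    by have := Rmult_le_compat_l _ _ _ (Rlt_le _ _ C0) hB; lra.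
  rewrite /E /expect_iter.
  (* With the first [k] samples fixed, [w] is constant and only the newest sample is averaged; the
     sampling and CG errors contribute 1/8 each. *)
  rewrite (avgT_rcons k (fun s : seq (beta.-tuple 'I_N) =>
    err (newton_cg_iter gF HF r w0 (map (fun S : beta.-tuple 'I_N => tval S) s)))).
  rewrite -!avgTZ -avgTD; apply: avgT_le => t; cbv beta.
  set w := newton_cg_iter _ _ _ _ _.
  apply: Rle_trans (_ : avgT (fun S : beta.-tuple 'I_N => (C * err w ^ 2 + 1 / 8 * err w) +
     / m * vnorm (mv (msub (hessS HF S w) (hessR HF w)) (vsub w wstar))) <= _).
    apply: avgT_le => S; rewrite map_rcons /newton_cg_iter foldl_rcons.
    rewrite -/(newton_cg_iter _ _ _ _ _) -/w.
    by have := step w S; lra.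
  rewrite avgTD avgT_const // avgTZ.
  have := Rmult_le_compat_l _ _ _ (Rlt_le _ _ im) (dev w).
  have -> : / m * (m / 8 * err w) = 1 / 8 * err w by field; lra.
  by move=> h; apply: Rle_trans (Rplus_le_compat_l _ _ _ h) _; lra.
have E0 : E 0%nat = err w0.
  rewrite /E /expect_iter -[RHS](avgT_const _ (Tn0 0%nat)); apply: avgT_ext => t.
  by rewrite (tuple0 t).
have hE : C * gamma * err w0 <= 1 / 4.
  have := Rle_trans _ _ _ hw0 (Rmin_r _ _); rewrite -/C -/(err w0) => h.
  have Cg : 0 < C * gamma by nra.
  have := Rmult_le_compat_l _ _ _ (Rlt_le _ _ Cg) h.
  by have -> : C * gamma * (1 / (4 * gamma * C)) = 1 / 4 by field; lra.
(* Halving holds as long as [E k] has not exceeded its initial value, and halving in turn preserves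
   that bound, so [bound] follows by induction. *)
have half k : E k <= err w0 -> E k.+1 <= 1 / 2 * E k.
  move=> hk; apply: Rle_trans (rec k) _; have Ek := E_ge0 k.
  have Cg : 0 < C * gamma by nra.
  have hCk : C * gamma * E k <= 1 / 4.
    by have := Rmult_le_compat_l _ _ _ (Rlt_le _ _ Cg) hk; lra.
  have := Rmult_le_compat_r _ _ _ Ek hCk; lra.
have bound k : E k <= err w0.
  elim: k => [|k IH]; first by rewrite E0; lra.
  by have := half k IH; have := E_ge0 k; lra.
by move=> k; exact: half k (bound k).
Qed.
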